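(* Let $n\ge1$, let $L\subseteq\{0,1,\dots,n-1\}$, $S_1=\{a^{2l}b,\ a^{-2l}b^2\mid l\in L\}$, and $S_2\subseteq\langle a^2\rangle a\cup\langle a^2\rangle ab\cup\langle a^2\rangle ab^2$, such that $S=S_1\cup S_2\subseteq U_{6n}$ satisfies $1\notin S=S^{-1}$. Put $S_L=\{a^{2l}\mid l\in L\}$ and assume $S_L=S_L^{-1}$. Then $\mathrm{Cay}(U_{6n},S)$ is integral if and only if all of the following hold for $0\le j\le 2n-1$ and $0\le k\le n-1$: (1) $S_L\in B(\langle a^2\rangle)$; (2) $\chi_j(S_2)$ is an integer; (3) $2\psi_k(S_2^2)$ is a perfect square (the square of an integer).
   Context: For an integer $n\ge1$, $U_{6n}=\langle a,b\mid a^{2n}=b^3=1,\ a^{-1}ba=b^{-1}\rangle$, a group of order $6n$ whose elements are uniquely $a^ib^\epsilon$ with $0\le i\le 2n-1$, $\epsilon\in\{0,1,2\}$. Let $\omega=\exp(\pi\imath/n)$. Its irreducible complex characters are: the $2n$ linear characters $\chi_j$ ($0\le j\le 2n-1$) given by $\chi_j(a^{2r}b^\epsilon)=\omega^{2jr}$ and $\chi_j(a^{2r+1}b^\epsilon)=\omega^{j(2r+1)}$ for all $\epsilon\in\{0,1,2\}$; and the $n$ degree-two characters $\psi_k$ ($0\le k\le n-1$) given by $\psi_k(a^{2r})=2\omega^{2kr}$, $\psi_k(a^{2r}b)=\psi_k(a^{2r}b^2)=-\omega^{2kr}$, $\psi_k(a^{2r+1}b^\epsilon)=0$. For a character $\chi$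 and a subset $A$, $\chi(A)=\sum_{x\in A}\chi(x)$ (with $\chi(\emptyset)=0$) and $\chi(A^2)=\sum_{x_1,x_2\in A}\chi(x_1x_2)$ over all ordered pairs. For a finite group $G$, the Boolean algebra $B(G)$ is the collection of subsets of $G$ obtainable from the subgroups of $G$ by finitely many unions, intersections and complements (in $G$). For a group $G$ and $S\subseteq G$ with $1\notin S=S^{-1}$, the Cayley graph $\mathrm{Cay}(G,S)$ has vertex set $G$ and edges $\{g,sg\}$ for $g\in G,s\in S$. A graph is integral if all eigenvalues of its adjacency matrix are integers. *)

(* Defs.v *)
From HB Require Import structures.
From mathcomp Require Import all_boot all_order all_algebra all_fingroup all_field all_character.
Set Implicit Arguments. Unset Strict Implicit. Unset Printing Implicit Defensive.
Import GRing.Theory Num.Theory.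

(* ---------- The group U_{6n} = < a, b | a^{2n} = b^3 = 1, a^-1 b a = b^-1 > *)
(* Concrete model: a^i b^e  <->  (i, e) in Z/2n x Z/3, with
   (a^i b^e)(a^j b^d) = a^(i+j) b^((-1)^j e + d). For n >= 1, 'Z_(n.*2) is Z/2n. *)

Definition U6 (n : nat) : Type := ('Z_(n.*2) * 'Z_3)%type.
HB.instance Definition _ n := Finite.on (U6 n).

Section U6Group.
Variable n : nat.
Local Open Scope ring_scope.

Definition U6sg (j : 'Z_(n.*2)) (e : 'Z_3) : 'Z_3 := if odd j then - e else e.

Definition U6mul (x y : U6 n) : U6 n := (x.1 + y.1, U6sg y.1 x.2 + y.2).
Definition U6one : U6 n := (0, 0).
Definition U6inv (x : U6 n) : U6 n := (- x.1, - U6sg x.1 x.2).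

Lemma U6_mod_even : odd (Zp_trunc n.*2).+2 = false.
Proof. by case: n => [|m] //=; rewrite doubleS /= odd_double. Qed.

Lemma U6_odd_add (j k : 'Z_(n.*2)) : odd (j + k)%R = odd j (+) odd k.
Proof. by rewrite /= odd_mod ?U6_mod_even // oddD. Qed.

Lemma U6_odd_opp (j : 'Z_(n.*2)) : odd (- j)%R = odd j.
Proof.
have := U6_odd_add j (- j); rewrite subrr /=.
by case: (odd j); case: (odd (- j)%R).
Qed.

Lemma U6mulA : associative U6mul.
Proof.
move=> [i e] [j d] [k f]; rewrite /U6mul /U6sg /= addrA U6_odd_add.
congr (_, _); case: (odd j); case: (odd k) => /=;
  by rewrite ?opprD ?opprK ?addrA.
Qed.

Lemma U6mul1 : left_id U6one U6mul.
Proof. by move=> [i e]; rewrite /U6mul /U6sg /= !add0r; case: ifP; rewrite ?oppr0 ?add0r. Qed.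

Lemma U6mulV : left_inverse U6one U6inv U6mul.
Proof.
move=> [i e]; rewrite /U6mul /U6inv /U6sg /= addNr; congr (_, _).
by case: (odd i); rewrite ?opprK addNr.
Qed.

End U6Group.

HB.instance Definition _ n :=
  Finite_isGroup.Build (U6 n) (@U6mulA n) (@U6mul1 n) (@U6mulV n).

Definition U6a (n : nat) : U6 n := (1%R, 0%R).
Definition U6b (n : nat) : U6 n := (0%R, 1%R).

Local Open Scope ring_scope.

(* omega = exp(pi i / n): n.-root (-1) is the n-th root of -1 with minimal
   non-negative argument, i.e. exp(pi i / n). *)
Definition omega (n : nat) : algC := n.-root (-1).

Definition chi (n j : nat) (x : U6 n) : algC := omega n ^+ (j * val x.1).

Definition psi (n k : nat) (x : U6 n) : algC :=
  if odd (val x.1) then 0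
  else if x.2 == 0 then 2 * omega n ^+ (k * val x.1)
  else - omega n ^+ (k * val x.1).

Definition char_set (gT : finGroupType) (f : gT -> algC) (A : {set gT}) : algC :=
  \sum_(x in A) f x.

Definition char_sq (gT : finGroupType) (f : gT -> algC) (A : {set gT}) : algC :=
  \sum_(x1 in A) \sum_(x2 in A) f (x1 * x2)%g.

Inductive in_boolalg (gT : finGroupType) (G : {group gT}) : {set gT} -> Prop :=
| BA_subgroup (H : {group gT}) : H \subset G -> in_boolalg G H
| BA_union (A B : {set gT}) : in_boolalg G A -> in_boolalg G B -> in_boolalg G (A :|: B)
| BA_inter (A B : {set gT}) : in_boolalg G A -> in_boolalg G B -> in_boolalg G (A :&: B)
| BA_compl (A : {set gT}) : in_boolalg G A -> in_boolalg G (G :\: A).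

Definition cay_adjacent (gT : finGroupType) (S : {set gT}) (g h : gT) : bool :=
  [exists s in S, (h == s * g)%g || (g == s * h)%g].

Definition cay_adj (gT : finGroupType) (S : {set gT}) : 'M[algC]_#|gT| :=
  \matrix_(i, j) (cay_adjacent S (enum_val i) (enum_val j))%:R.

Definition integral_mx (m : nat) (A : 'M[algC]_m) : Prop :=
  forall lambda : algC, eigenvalue A lambda -> lambda \in Num.int.

(* Main.v *)
Require Import Defs.
From HB Require Import structures.
From mathcomp Require Import all_boot all_order all_algebra all_fingroup all_field all_character.
From mathcomp Require Import ring.
Set Implicit Arguments. Unset Strict Implicit. Unset Printing Implicit Defensive.
Import GRing.Theory Num.Theory.
Local Open Scope group_scope.

(* The eigenvalues of Cay(G, S) are those of rho(S) for rho running over the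
   irreducible representations.  Here chi_j(S) = 2 sigma_j + chi_j(S2) with
   sigma_j = chi_j(S_L), while the two-dimensional representations give
   - sigma_k I + Q_k with Q_k antidiagonal and Q_k^2 = (psi_k(S2^2) / 2) I, hence
   the eigenvalues - sigma_k +- sqrt (psi_k(S2^2) / 2).  These two are integers
   iff sigma_k is one and 2 psi_k(S2^2) is a perfect square.  Finally all sigma_k
   are integers iff S_L is a union of classes of the relation <[x]> = <[y]>
   (Fourier inversion and Galois conjugation for one direction, inclusion-exclusion
   over cyclic subgroups for the other), that is, iff S_L lies in B(<a^2>). *)

(** * Primitivity of [omega n] as a 2n-th root of unity *)

Section Omega.
Import Order.TTheory.
Local Open Scope ring_scope.

(** With theta and phi the arguments of [w] and [y], the last hypothesis reads cos (phi - 2 theta)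
    <= cos phi and forces phi <= theta, while ['Re y <= 'Re w] forces theta <= phi. The auxiliary
    [y'] has argument phi - theta, so the former bound becomes ['Im y' <= 0]. *)
Lemma unit_circle_closest (C : numClosedFieldType) (w y : C) :
  `|w| = 1 -> `|y| = 1 -> 0 < 'Im w -> 0 <= 'Re w -> 0 <= 'Im y ->
  'Re y <= 'Re w -> 'Re (y * w^* ^+ 2) <= 'Re y -> y = w.
Proof.
move=> w1 y1 q_gt0 p_ge0 s_ge0 le_cp le_rot.
have w0 : w * w^* = 1 by rewrite -normCK w1 expr1n.
pose y' := y * w^*.
have yE : y = w * y' by rewrite /y' mulrCA w0 mulr1.
have n1 : 'Re y' ^+ 2 + 'Im y' ^+ 2 = 1.
  by rewrite -normC2_Re_Im normrM y1 norm_conjC w1 mulr1 expr1n.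
have b_le0 : 'Im y' <= 0.
  move: le_rot; rewrite expr2 mulrA -/y' -subr_ge0 [in 'Re y]yE !ReM Re_conj Im_conj.
  set e := (X in 0 <= X); have -> : e = - ('Im w * 'Im y' * 2%:R) by rewrite /e; ring.
  by rewrite oppr_ge0 pmulr_lle0 ?ltr0n // pmulr_rle0.
have sE : 'Im w * 'Re y' = 'Im y - 'Re w * 'Im y' by rewrite [in RHS]yE ImM; ring.
have a_ge0 : 0 <= 'Re y'.
  by rewrite -(pmulr_rge0 _ q_gt0) sE subr_ge0 (le_trans _ s_ge0) ?mulr_ge0_le0.
have a_le1 : 'Re y' <= 1.
  rewrite -(@ler_pXn2r _ 2) ?nnegrE // expr1n -n1 lerDl.
  by rewrite real_exprn_even_ge0 ?Creal_Im.
have s_le : 'Im y <= 'Im w.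
  apply: le_trans (_ : 'Im w * 'Re y' <= _); last by rewrite ger_pMr.
  by rewrite sE lerDl oppr_ge0 mulr_ge0_le0.
have c_ge0 : 0 <= 'Re y.
  rewrite yE ReM subr_ge0 (le_trans _ (mulr_ge0 p_ge0 a_ge0)) //.
  by rewrite mulr_ge0_le0 // ltW.
have ReE : 'Re y = 'Re w.
  apply/le_anti; rewrite le_cp /= -(@ler_pXn2r _ 2) ?nnegrE //.
  have := normC2_Re_Im y; have := normC2_Re_Im w; rewrite w1 y1 => -> e.
  by rewrite -(lerD2r ('Im w ^+ 2)) e lerD2l ler_pXn2r ?nnegrE // ltW.
by apply: eqC_semipolar; rewrite ?w1 ?y1 // mulr_ge0 // ltW.
Qed.

Lemma norm_unity_root (C : numClosedFieldType) n (v : C) :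
  (0 < n)%N -> v ^+ n = 1 -> `|v| = 1.
Proof.
move=> n_gt0 vn; apply/eqP; rewrite -(@pexpr_eq1 _ _ n) -?lt0n //.
by rewrite -normrX vn normr1.
Qed.

Lemma sum_expr_unity (F : fieldType) n (z : F) :
  z ^+ n = 1 -> \sum_(i < n) z ^+ i = (if z == 1 then n%:R else 0).
Proof.
case: eqP => [-> _|/eqP nz zn1].
  under eq_bigr do rewrite expr1n.
  by rewrite sumr_const card_ord.
apply/eqP; have := subrX1 z n; rewrite zn1 subrr => /esym/eqP.
by rewrite mulf_eq0 subr_eq0 (negPf nz).
Qed.

Lemma omegaXn n : (0 < n)%N -> omega n ^+ n = -1.
Proof. by move=> n_gt0; rewrite /omega rootCK. Qed.

Lemma omegaX2n n : (0 < n)%N -> omega n ^+ n.*2 = 1.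
Proof. by move=> n_gt0; rewrite -muln2 exprM omegaXn // sqrrN expr1n. Qed.

(** [rootC_Re_max] handles roots of nonnegative imaginary part; any other root is replaced by its
    conjugate, again a root because -1 is real. *)
Lemma omega_Re_max n (v : algC) :
  (1 < n)%N -> v ^+ n = -1 -> 'Re v <= 'Re (omega n).
Proof.
move=> n_gt1 vn; have n_gt0 := ltnW n_gt1.
have [Iv|Iv] := real_leP (real0 _) (Creal_Im v).
  exact: rootC_Re_max.
rewrite -Re_conj; apply: rootC_Re_max => //.
  by rewrite -rmorphXn vn rmorphN rmorph1.
by rewrite Im_conj oppr_ge0 ltW.
Qed.

(** The n roots of X^n + 1 sum to zero, so their maximal real part is nonnegative. Were [w] real, it
    would be nonnegative, and so would its n-th power -1. *)
Lemma omega_Im_gt0 n : (1 < n)%N -> 0 < 'Im (omega n) /\ 0 <= 'Re (omega n).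
Proof.
move=> n_gt1; have n_gt0 := ltnW n_gt1; set w := omega n.
have [z z_prim] := C_prim_root_exists n_gt0.
have p_ge0 : 0 <= 'Re w.
  have sum0 : \sum_(i < n) w * z ^+ i = 0.
    rewrite -mulr_sumr sum_expr_unity ?prim_expr_order //.
    have := eq_prim_root_expr z_prim 1 0; rewrite expr1 expr0 => ->.
    by rewrite eqn_mod_dvd // subn0 dvdn1 eqn_leq leqNgt n_gt1 mulr0.
  have : \sum_(i < n) 'Re (w * z ^+ i) <= \sum_(i < n) 'Re w.
    apply: ler_sum => i _; apply: omega_Re_max => //.
    by rewrite exprMn omegaXn // exprAC (prim_expr_order z_prim) expr1n mulr1.
  by rewrite -raddf_sum sum0 raddf0 sumr_const card_ord pmulrn_lge0.
split=> //; rewrite lt_def Im_rootC_ge0 // andbT.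
apply/eqP => q0.
have := omegaXn n_gt0; rewrite -/w [w]algCrect q0 mulr0 addr0 => e.
have : 0 <= (-1 : algC) by rewrite -e exprn_ge0.
by rewrite oppr_ge0 ler10.
Qed.

(* A root v of X^n + 1 is rotated by powers of omega^2 until its real part is
   maximal; it then is omega or its conjugate. *)
Lemma omega_generates n (v : algC) :
  (0 < n)%N -> v ^+ n = -1 -> exists i, v = omega n ^+ i.
Proof.
move=> n_gt0 vn; set w := omega n.
have [n_gt1|n_le1] := ltnP 1 n; last first.
  have n1 : n = 1%N by apply/eqP; rewrite eqn_leq n_le1.
  by exists 1%N; rewrite -[LHS]expr1 /w -n1 vn omegaXn.
have [q_gt0 p_ge0] := omega_Im_gt0 n_gt1.
have n2_gt0 : (0 < n.*2)%N by rewrite double_gt0.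
have w1 : `|w| = 1 by apply: (norm_unity_root n2_gt0); apply: omegaX2n.
have wc : w * w^* = 1 by rewrite -normCK w1 expr1n.
pose y (k : nat) := v * (w ^+ 2) ^+ k.
have yn k : y k ^+ n = -1.
  by rewrite exprMn vn -!exprM mulnAC mul2n exprM omegaX2n // expr1n mulr1.
have y1 k : `|y k| = 1.
  by apply: (norm_unity_root n2_gt0); rewrite -muln2 exprM yn sqrrN expr1n.
have ymod k : y k = y (k %% n)%N.
  rewrite /y [in LHS](divn_eq k n) exprD mulnC exprM -[(w ^+ 2) ^+ n]exprM mul2n.
  by rewrite omegaX2n // expr1n mul1r.
have [i0] : {i : 'I_n | true} by exists (Ordinal n_gt0).
have := @real_arg_maxP _ _ i0 xpredT (fun k : 'I_n => 'Re (y k)) isT.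
move=> /(_ (fun k _ => Creal_Re _)) [k _ kmax] _.
have {}kmax j : 'Re (y j) <= 'Re (y k).
  by rewrite ymod; apply: (kmax (Ordinal (ltn_pmod j n_gt0))).
have up : y k.+1 = y k * w ^+ 2 by rewrite /y exprSr mulrA.
(* The index k + n - 1 stands for k - 1, since [y] has period n. *)
have down : y (k + n.-1)%N = y k * w^* ^+ 2.
  rewrite /y exprD -!mulrA; congr (_ * (_ * _)).
  apply: (@mulIf _ (w ^+ 2)); first by rewrite expf_neq0 // -normr_eq0 w1 oner_eq0.
  rewrite -exprSr prednK // -exprM mul2n omegaX2n //.
  by rewrite -exprMn mulrC wc expr1n.
have vE : v = y k * (w^* ^+ 2) ^+ k.
  by rewrite /y -mulrA -exprMn -exprMn wc !expr1n mulr1.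
have wcE : w^* = w ^+ (n.*2).-1.
  apply: (@mulfI _ w); first by rewrite -normr_eq0 w1 oner_eq0.
  by rewrite wc -exprS prednK // omegaX2n.
suff: y k = w \/ y k = w^*.
  by rewrite vE wcE => -[] ->; rewrite -!exprM -?exprD -?exprS; eexists.
(* A maximizer in the upper half plane is compared with its neighbour [down]; one in the lower half
   plane is conjugated first, and then [up] gives the required bound. *)
have [Iy|Iy] := real_leP (real0 _) (Creal_Im (y k)); [left|right].
  by apply: unit_circle_closest; rewrite // ?omega_Re_max // -down.
apply: (can_inj conjCK); rewrite conjCK.
apply: unit_circle_closest; rewrite // ?norm_conjC ?Re_conj ?Im_conj ?omega_Re_max //.
  by rewrite oppr_ge0 ltW.
by rewrite -rmorphXn -rmorphM Re_conj -up.
Qed.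

(** A primitive 2n-th root of unity [z] satisfies z^n = -1, hence is a power of omega, so 2n divides
    the order of omega. *)
Lemma omega_prim n : (0 < n)%N -> (n.*2).-primitive_root (omega n).
Proof.
move=> n_gt0; have n2_gt0 : (0 < n.*2)%N by rewrite double_gt0.
have [z z_prim] := C_prim_root_exists n2_gt0.
have zn : z ^+ n = -1.
  have : z ^+ n ^+ 2 = 1 by rewrite -exprM muln2 prim_expr_order.
  move/eqP; rewrite sqrf_eq1 => /pred2P[] // zn1.
  have := prim_order_dvd z_prim n; rewrite zn1 eqxx => /(dvdn_leq n_gt0).
  by rewrite -addnn -{3}[n]addn0 leq_add2l leqNgt n_gt0.
have [i zE] := omega_generates n_gt0 zn.
have [d d_prim d_dvd] := prim_order_exists n2_gt0 (omegaX2n n_gt0).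
suff -> : n.*2 = d by [].
apply/eqP; rewrite eqn_dvd d_dvd andbT (prim_order_dvd z_prim).
by rewrite zE exprAC (prim_expr_order d_prim) expr1n.
Qed.

End Omega.

(** * The Boolean algebra of a finite group and its atoms *)

Section BooleanAlgebra.
Variables (gT : finGroupType) (G : {group gT}).
Implicit Types (A B : {set gT}) (x y : gT).

(** Inside G, the classes of the relation [<[x]> = <[y]>] are the atoms of B(G), so for subsets of G
    this property amounts to membership in B(G). *)
Definition gen_closed A := forall x y, <[x]> = <[y]> -> x \in A -> y \in A.

Lemma in_boolalg_gen_closed A : in_boolalg G A -> gen_closed A.
Proof.
elim=> {A} [H _|A B _ cA _ cB|A B _ cA _ cB|A _ cA] x y xy.
- by rewrite -!cycle_subG xy.
- by rewrite !inE => /orP[/(cA _ _ xy)|/(cB _ _ xy)] ->; rewrite ?orbT.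
- by rewrite !inE => /andP[/(cA _ _ xy) -> /(cB _ _ xy)].
rewrite !inE -!cycle_subG xy => /andP[nA ->]; rewrite andbT.
by apply: contra nA; apply: cA.
Qed.

Lemma in_boolalg0 : in_boolalg G set0.
Proof. by rewrite -(setDv G); apply: BA_compl; apply: BA_subgroup. Qed.

Lemma in_boolalg_bigcup (I : finType) (P : pred I) (F : I -> {set gT}) :
  (forall i, P i -> in_boolalg G (F i)) -> in_boolalg G (\bigcup_(i | P i) F i).
Proof.
move=> BF; elim/big_ind: _ => // [|A B]; [exact: in_boolalg0 | exact: BA_union].
Qed.

(* The generators of <[x]> are what remains after removing every cyclic
   subgroup <[y]> not containing x. *)
Lemma gen_closed_in_boolalg A : A \subset G -> gen_closed A -> in_boolalg G A.
Proof.
move=> sAG cA.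
have -> : A = \bigcup_(x in A) (<[x]> :&: (G :\: \bigcup_(y in G | x \notin <[y]>) <[y]>)).
  apply/setP=> z; apply/idP/bigcupP => [zA|[x xA]].
    exists z => //; rewrite !inE cycle_id (subsetP sAG _ zA) andbT /=.
    by apply/bigcupP=> -[y /andP[_ /negP]].
  rewrite !inE => /andP[zx /andP[nz zG]]; apply: cA (xA).
  apply/eqP; rewrite eqEsubset !cycle_subG zx andbT; apply: contraR nz => nxz.
  by apply/bigcupP; exists z; rewrite ?zG ?cycle_id.
apply: in_boolalg_bigcup => x /(subsetP sAG) xG; apply: BA_inter.
  by apply: BA_subgroup; rewrite cycle_subG.
apply: BA_compl; apply: in_boolalg_bigcup => y /andP[yG _].
by apply: BA_subgroup; rewrite cycle_subG.
Qed.

End BooleanAlgebra.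

(** * Integrality of linear characters summed over unions of atoms *)

Section IntegralSums.
Variables (gT : finGroupType) (f : gT -> algC).
Hypotheses (f1 : f 1 = 1%R) (fM : {morph f : x y / x * y >-> (x * y)%R}).
Local Open Scope ring_scope.

Lemma mult_fun_expg x k : f (x ^+ k)%g = f x ^+ k.
Proof. by elim: k => [|k IH]; rewrite ?expg0 // expgS fM IH exprS. Qed.

Lemma mult_fun_unity x : f x ^+ #[x]%g = 1.
Proof. by rewrite -mult_fun_expg expg_order. Qed.

Lemma mult_fun_invg x : f x^-1%g = (f x)^-1.
Proof.
have e : f x^-1%g * f x = 1 by rewrite -fM mulVg.
have nz : f x != 0 by apply/eqP=> f0; move/eqP: e; rewrite f0 mulr0 eq_sym oner_eq0.
by apply: (mulIf nz); rewrite e mulVf.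
Qed.

Lemma mult_fun_Aint x : f x \in Aint.
Proof.
apply: (@Aint_unity_root #[x]%g); first exact: order_gt0.
by apply/unity_rootP; apply: mult_fun_unity.
Qed.

Lemma char_set_Aint (A : {set gT}) : char_set f A \in Aint.
Proof. by apply: rpred_sum => x _; apply: mult_fun_Aint. Qed.

(** Translation by [h] in H multiplies the sum by [f h], so the sum vanishes unless [f] is 1 on all
    of H, and then it is the order of H. *)
Lemma char_set_group_int (H : {group gT}) : char_set f H \in Num.int.
Proof.
have [fH|/forall_inPn[h hH /eqP fh]] := altP (@forall_inP _ (mem H) (fun x => f x == 1)).
  rewrite /char_set (eq_bigr (fun=> 1)) => [|x /fH/eqP//].
  by rewrite sumr_const rpred_nat.
suff -> : char_set f H = 0 by [].
apply/eqP; have : char_set f H = f h * char_set f H.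
  rewrite /char_set mulr_sumr [LHS](reindex_inj (mulgI h)) /=.
  by apply: eq_big => x; rewrite ?groupMl // fM.
move/eqP; rewrite -subr_eq0 -{1}[char_set f H]mul1r -mulrBl mulf_eq0 subr_eq0.
by rewrite eq_sym (introF eqP fh).
Qed.

Lemma char_set_generators (A : {set gT}) :
  gen_closed A -> (forall x, x \in A -> char_set f [set y | <[y]>%g == <[x]>%g] \in Num.int) ->
  char_set f A \in Num.int.
Proof.
move=> cA intA; rewrite /char_set (partition_big (fun y => <[y]>%G) xpredT) //=.
apply: rpred_sum => H _.
have [x /andP[xA /eqP xH]|no] := pickP [pred x | (x \in A) && (<[x]>%G == H)]; last first.
  by rewrite big_pred0 // rpred0.
suff -> : \sum_(y in A | <[y]>%G == H) f y = char_set f [set y | <[y]>%g == <[x]>%g].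
  exact: intA.
apply: eq_bigl => y; rewrite !inE -xH -val_eqE /=.
apply/andP/eqP=> [[_ /eqP//]|yx]; split; last exact/eqP.
by apply: cA xA.
Qed.

(** Strong induction on the order of [x]: the generators of [<[x]>] are the whole cyclic group minus
    a union of classes of elements of smaller order. *)
Lemma char_set_generators_int x : char_set f [set y | <[y]>%g == <[x]>%g] \in Num.int.
Proof.
have [m] := ubnP #[x]%g; elim: m x => // m IH x; rewrite ltnS => le_xm.
have -> : char_set f [set y | <[y]>%g == <[x]>%g] =
   char_set f <[x]>%g - char_set f (<[x]> :\: [set y | <[y]>%g == <[x]>%g])%g.
  rewrite /char_set [X in X - _](big_setID [set y | <[y]>%g == <[x]>%g]) /= addrK.
  apply: eq_bigl => y; rewrite !inE; apply/esym/andb_idl=> /eqP <-.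
  exact: cycle_id.
rewrite rpredB ?char_set_group_int //; apply: char_set_generators.
  by move=> y z yz; rewrite !inE -!cycle_subG yz.
move=> y; rewrite !inE => /andP[nyx yx]; apply: IH; apply: leq_trans le_xm.
by apply: proper_card; rewrite properEneq nyx cycle_subG.
Qed.

Lemma gen_closed_char_set_int (A : {set gT}) : gen_closed A -> char_set f A \in Num.int.
Proof. by move=> cA; apply: char_set_generators => // x _; apply: char_set_generators_int. Qed.

End IntegralSums.

(** * Integral Fourier coefficients force closure under generators *)

Section RationalSums.
Variables (gT : finGroupType) (C : {group gT}) (I : finType) (f : I -> gT -> algC).
Hypotheses (f1 : forall i, f i 1 = 1%R).
Hypotheses (fM : forall i, {morph f i : x y / x * y >-> (x * y)%R}).
Variable c : algC.
Hypothesis c_neq0 : (c != 0)%R.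
Hypothesis sumf : forall x, x \in C -> (\sum_i f i x = if x == 1%g then c else 0)%R.
Local Open Scope ring_scope.

(* Fourier inversion: the indicator of A is a combination of the f i with
   coefficients char_set (f i) A fixed by field automorphisms. *)
Lemma char_set_int_gen_closed (A : {set gT}) :
  A \subset C -> (forall i, char_set (f i) A \in Num.int) -> gen_closed A.
Proof.
move=> sAC intA x y xy xA.
have xC := subsetP sAC x xA.
have yC : y \in C by rewrite -cycle_subG -xy cycle_subG.
have inv z : z \in C -> \sum_i char_set (f i) A * f i z^-1%g = if z \in A then c else 0.
  move=> zC; under eq_bigr do rewrite mulr_suml.
  rewrite exchange_big /= (eq_bigr (fun w => if w == z then c else 0)); last first.
    move=> w wA; under eq_bigr do rewrite -fM.
    have wzC : (w * z^-1)%g \in C by rewrite groupM ?groupV // (subsetP sAC).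
    by rewrite sumf // (eq_mulgV1 w z).
  have [zA|nzA] := boolP (z \in A).
    by rewrite (bigD1 z) //= eqxx big1 ?addr0 // => w /andP[_ /negPf->].
  by rewrite big1 // => w wA; case: eqP => // wz; rewrite -wz wA in nzA.
have [r yr] : exists r, y = (x ^+ r)%g.
  by have /cycleP : y \in <[x]>%g by rewrite xy cycle_id.
(* Since r is prime to the order of [x], some automorphism [u] of [algC] raises the roots of unity
   of that order to the power r. It carries the inversion sum at [x], equal to c, to the one at [y],
   which is therefore nonzero. *)
have co : coprime r #[x]%g.
  by rewrite coprime_sym -cyclic.generator_coprime /cyclic.generator xy -yr.
have [u uE] := Qn_aut_exists co.
have := inv y yC; rewrite (eq_bigr (fun i => u (char_set (f i) A * f i x^-1%g))).
  rewrite -rmorph_sum inv // xA; case: ifP => // _ /eqP.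
  by rewrite fmorph_eq0 (negPf c_neq0).
move=> i _; rewrite rmorphM; congr (_ * _).
  by rewrite aut_Crat // rpred_int_num.
rewrite uE ?mult_fun_invg //; last by rewrite exprVn mult_fun_unity // invr1.
by rewrite yr mult_fun_expg // exprVn.
Qed.

End RationalSums.

(** * Eigenvalues of a Cayley graph from representations *)

Section CayleySpectrum.
Variables (gT : finGroupType) (S : {set gT}).
Hypothesis SV : S^-1 = S.

Lemma cay_adjacentE g h : cay_adjacent S g h = (g * h^-1 \in S).
Proof.
apply/exists_inP/idP => [[s sS /orP[]/eqP->]|ghS].
- by rewrite -SV inE invMg invgK mulgK.
- by rewrite mulgK.
by exists (g * h^-1); rewrite ?mulgKV ?eqxx ?orbT.
Qed.

Local Open Scope ring_scope.

(** Row vectors are read as functions on the group; the adjacency matrix sums their left translates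
    over S. *)
Lemma mul_cay_adj (v : 'rV[algC]_#|gT|) h :
  (v *m cay_adj S) 0 (enum_rank h) = \sum_(s in S) v 0 (enum_rank (s * h)%g).
Proof.
rewrite mxE (reindex_onto enum_rank enum_val) => [|i _]; last exact: enum_valK.
rewrite (eq_bigl xpredT) => [|g]; last by rewrite enum_rankK eqxx.
rewrite (reindex_inj (mulIg h)) [RHS]big_mkcond /=; apply: eq_bigr => s _.
by rewrite mxE !enum_rankK cay_adjacentE mulgK; case: ifP; rewrite ?mulr1 ?mulr0.
Qed.

Section Representation.
Variables (m : nat) (rho : gT -> 'M[algC]_m).
Hypotheses (rho1 : rho 1%g = 1%:M) (rhoM : forall x y, rho (x * y)%g = rho x *m rho y).

Lemma char_sq_mxtrace (A : {set gT}) :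
  char_sq (fun x => \tr (rho x)) A =
  \tr ((\sum_(x in A) rho x) *m (\sum_(x in A) rho x)).
Proof.
rewrite mulmx_suml raddf_sum; apply: eq_bigr => x _.
rewrite mulmx_sumr raddf_sum; apply: eq_bigr => y _.
by rewrite rhoM.
Qed.

(** For a row eigenvector [u] of the image of S, the coefficient function taking x to entry j of
    [u *m rho x] is an eigenvector of the graph. It is nonzero because its value at 1 is [u 0 j]. *)
Lemma eigenvalue_cay_adj lambda :
  eigenvalue (\sum_(s in S) rho s) lambda -> eigenvalue (cay_adj S) lambda.
Proof.
case/eigenvalueP=> u uS nz_u; have [j nz_uj] : exists j, u 0 j != 0.
  apply/existsP; apply: contraR nz_u; rewrite negb_exists => /forallP u0.
  by apply/eqP/rowP=> j; rewrite mxE; apply/eqP/negPn.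
apply/eigenvalueP; exists (\row_i (u *m rho (enum_val i)) 0 j).
  apply/rowP=> i; rewrite -[i]enum_valK mul_cay_adj !mxE enum_rankK.
  transitivity ((u *m (\sum_(s in S) rho s) *m rho (enum_val i)) 0 j).
    rewrite -mulmxA mulmx_suml mulmx_sumr summxE; apply: eq_bigr => s _.
    by rewrite mxE enum_rankK rhoM.
  by rewrite uS -scalemxAl mxE mxE.
apply: contraNneq nz_uj => /rowP/(_ (enum_rank 1%g)).
by rewrite mxE [in RHS]mxE enum_rankK rho1 mulmx1 => ->.
Qed.

(* The Fourier transform of an eigenvector v at rho is a matrix whose rows are
   eigenvectors of the image of S. *)
Lemma eigenvector_cay_adj_orthogonal lambda (v : 'rV[algC]_#|gT|) :
  v *m cay_adj S = lambda *: v -> ~~ eigenvalue (\sum_(s in S) rho s) lambda ->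
  forall x, \sum_h v 0 (enum_rank h) * \tr (rho (h^-1 * x)%g) = 0.
Proof.
move=> vS no_eig x; pose M := \sum_h v 0 (enum_rank h) *: rho h^-1%g.
have MS : M *m (\sum_(s in S) rho s) = lambda *: M.
  rewrite /M scaler_sumr mulmx_sumr.
  transitivity (\sum_h \sum_(s in S) v 0 (enum_rank (s * h)%g) *: rho h^-1%g).
    rewrite exchange_big; apply: eq_bigr => s _ /=.
    rewrite mulmx_suml (reindex_inj (mulgI s)); apply: eq_bigr => h _ /=.
    by rewrite -scalemxAl -rhoM invMg mulgKV.
  apply: eq_bigr => h _; rewrite -scaler_suml -mul_cay_adj vS.
  by rewrite mxE scalerA.
have M0 : M = 0.
  apply/row_matrixP => i; rewrite row0; apply/eqP; apply: contraR no_eig => nz.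
  by apply/eigenvalueP; exists (row i M); rewrite // -row_mul MS linearZ.
transitivity (\tr (M *m rho x)); last by rewrite M0 mul0mx mxtrace0.
rewrite mulmx_suml raddf_sum; apply: eq_bigr => h _ /=.
by rewrite -scalemxAl linearZ /= rhoM.
Qed.

End Representation.

End CayleySpectrum.

(** * Characters of U_6n and their orthogonality *)

Section Omega6.
Variable n : nat.
Hypothesis n_gt0 : (0 < n)%N.
Local Notation a := (U6a n).
Local Notation b := (U6b n).
Local Open Scope ring_scope.

(** The modulus of ['Z_m] is m only for m at least 2; positivity of n ensures this for m = 2n. *)
Lemma U6_modulus : (Zp_trunc n.*2).+2 = n.*2.
Proof. by apply: Zp_cast; rewrite -addnn; case: n n_gt0 => // m _; rewrite addnS ltnS. Qed.

Lemma omega_exp_mod i : omega n ^+ (i %% (Zp_trunc n.*2).+2)%N = omega n ^+ i.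
Proof. by rewrite U6_modulus; apply: prim_expr_mod (omega_prim n_gt0) i. Qed.

Lemma omega_expD k (i j : 'Z_n.*2) :
  omega n ^+ (k * val (i + j)) = omega n ^+ (k * val i) * omega n ^+ (k * val j).
Proof.
by rewrite -exprD -mulnDr !(mulnC k) !exprM /= omega_exp_mod.
Qed.

Lemma chi1 k : chi k (1%g : U6 n) = 1.
Proof. by rewrite /chi /= muln0. Qed.

Lemma chiM k : {morph @chi n k : x y / (x * y)%g >-> x * y}.
Proof. by move=> x y; apply: omega_expD. Qed.

Lemma U6aX m : (a ^+ m)%g = (m%:R, 0) :> U6 n.
Proof.
elim: m => [|m IH] //.
rewrite expgSr IH mulrSr; congr (_, _) => /=.
by rewrite addr0 /U6sg oppr0; case: (odd _).
Qed.

Lemma mem_a2 (x : U6 n) : (x \in <[a ^+ 2]>%g) = ~~ odd x.1 && (x.2 == 0).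
Proof.
apply/cycleP/andP => [[m ->]|[ev /eqP x2]].
  rewrite -expgM U6aX /=; split=> //.
  by rewrite Zp_nat /= odd_mod ?U6_mod_even // oddM.
exists (val x.1)./2; rewrite -expgM U6aX mul2n halfK (negPf ev) subn0.
by rewrite natr_Zp -x2; case: x {ev x2}.
Qed.

Lemma omega_even (i : nat) : ~~ odd i -> (omega n ^+ i) ^+ n = 1.
Proof.
move=> ev; rewrite -exprM -[i]odd_double_half (negPf ev) add0n -muln2 -mulnA mul2n.
by rewrite mulnC exprM omegaX2n // expr1n.
Qed.

Lemma omega_val_eq1 (i : 'Z_n.*2) : (omega n ^+ val i == 1) = (i == 0).
Proof.
rewrite -(prim_order_dvd (omega_prim n_gt0)) -(inj_eq val_inj) /=.
have := ltn_ord i; rewrite [X in (_ < X)%N]U6_modulus => lt_i.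
by rewrite -{2}(modn_small lt_i).
Qed.

Lemma sum_omega_even (i : 'Z_n.*2) : ~~ odd i ->
  \sum_(k < n) omega n ^+ (k * val i) = if i == 0 then n%:R else 0.
Proof.
move=> ev; under eq_bigr do rewrite mulnC exprM.
by rewrite sum_expr_unity ?omega_even // omega_val_eq1.
Qed.

(** The first n characters restrict to all the characters of the cyclic group [<[a ^+ 2]>] of order
    n, so they suffice for Fourier inversion there. *)
Lemma sum_chi_even (x : U6 n) : x \in <[a ^+ 2]>%g ->
  \sum_(k < n) chi k x = if x == 1%g then n%:R else 0.
Proof.
rewrite mem_a2 => /andP[ev x2]; rewrite sum_omega_even //.
by case: x ev x2 => i e /= _ /eqP->; congr (if _ then _ else _); rewrite xpair_eqE eqxx andbT.
Qed.

Lemma sum_chi (x : U6 n) :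
  \sum_(j < n.*2) chi j x = if x.1 == 0 then n.*2%:R else 0.
Proof.
under eq_bigr do rewrite /chi mulnC exprM.
rewrite sum_expr_unity ?omega_val_eq1 //.
by rewrite exprAC omegaX2n // expr1n.
Qed.

(** This is the decomposition of the regular character: each irreducible character is weighted by
    its degree. *)
Lemma regular_character (x : U6 n) :
  \sum_(j < n.*2) chi j x + 2 * \sum_(k < n) psi k x =
  if x == 1%g then (6 * n)%:R else 0.
Proof.
rewrite sum_chi; case: x => i e.
have -> : ((i, e) == 1%g :> U6 n) = (i == 0) && (e == 0) by rewrite -xpair_eqE.
rewrite /psi /=; have [od|ev] := boolP (odd i).
  rewrite big1 // mulr0 addr0; case: eqP => // i0.
  by rewrite i0 in od.
have [_|_] := eqVneq e 0.
  rewrite -mulr_sumr sum_omega_even // andbT; case: eqP => _; last by rewrite !mulr0 addr0.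
  by rewrite mulrA -!natrM -natrD -muln2 mulnC -mulnDl.
rewrite sumrN sum_omega_even // andbF; case: eqP => _; last by rewrite oppr0 mulr0 addr0.
by rewrite mulrN -natrM mul2n subrr.
Qed.

End Omega6.

(** The characteristic polynomial is (X - d)^2 - [M 0 1 * M 1 0]. *)
Lemma eigenvalue_mx2 (F : fieldType) (M : 'M[F]_2) (d lambda : F) :
  (M 0 0 = d -> M 1 1 = d ->
  eigenvalue M lambda = ((lambda - d) ^+ 2 == M 0 1 * M 1 0))%R.
Proof.
move=> M0 M1; rewrite eigenvalue_root_char /root /char_poly.
rewrite (expand_det_row _ 0%R) !big_ord_recl big_ord0 addr0 /cofactor !det_mx11 !mxE /=.
have -> : lift ord0 ord0 = 1%R :> 'I_2 by apply: val_inj.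
have -> : lift 1%R 0%R = 0%R :> 'I_2 by apply: val_inj.
rewrite -[ord0]/(0%R : 'I_2) M0 M1 !mulr1n !mulr0n /= /bump /= addn0 expr0 expr1.
rewrite mul1r !sub0r !hornerE /= -[RHS]subr_eq0; congr (_ == _); ring.
Qed.

(** * Two-dimensional representations of U_6n *)

Section Representations.
Variable n : nat.
Hypothesis n_gt0 : (0 < n)%N.
Variable z : algC.
Hypothesis z_prim : (3.-primitive_root z)%R.
Local Notation b := (U6b n).
Local Open Scope ring_scope.

Definition zpow (e : 'Z_3) : algC := z ^+ val e.

Lemma zpowD (e d : 'Z_3) : zpow (e + d) = zpow e * zpow d.
Proof. by rewrite -exprD; apply: (prim_expr_mod z_prim). Qed.

(** For e nonzero this is 1 + z + z^2 = 0. *)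
Lemma zpow_sum (e : 'Z_3) : zpow e + zpow (- e) = if e == 0 then 2 else -1.
Proof.
have z1 : z != 1.
  apply/eqP=> z1; have := eq_prim_root_expr z_prim 1 0.
  by rewrite z1 !expr1n eqxx.
have := sum_expr_unity (prim_expr_order z_prim).
rewrite (negPf z1) !big_ord_recl big_ord0 /= /bump /= expr0 addr0 => /eqP.
rewrite addr_eq0 => /eqP/(congr1 -%R); rewrite opprK => sumz.
rewrite /zpow; case: e => [[|[|[|//]]] lt_e] //=; exact: etrans (addrC _ _) (esym sumz).
Qed.

(* The representation induced from <a^2, b>: b acts as diag(z, z^-1), and a as
   omega^k times the transposition. *)
Definition rho (k : nat) (x : U6 n) : 'M[algC]_2 :=
  \matrix_(p, q) if odd x.1 == (p != q)
    then omega n ^+ (k * val x.1) * zpow (if q == 0 then x.2 else - x.2) else 0.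

Lemma rho1 k : rho k 1%g = 1%:M.
Proof.
apply/matrixP=> p q; rewrite !mxE /= muln0 expr0 mul1r oppr0 if_same /zpow expr0.
by rewrite eq_sym eqbF_neg negbK; case: eqP.
Qed.

Lemma rhoM k x y : rho k (x * y)%g = rho k x *m rho k y.
Proof.
case: x y => [i e] [j d]; apply/matrixP=> p q.
rewrite !mxE !big_ord_recl big_ord0 !mxE addr0 /= U6_odd_add omega_expD //.
rewrite /U6sg; case: p q => [[|[|//]] lt_p] [[|[|//]] lt_q];
  rewrite -!val_eqE /=; case: (odd i); case: (odd j) => /=;
  rewrite ?mul0r ?mulr0 ?add0r ?addr0 // ?opprD ?opprK zpowD; ring.
Qed.

Lemma mxtrace_rho k x : \tr (rho k x) = psi k x.
Proof.
rewrite /mxtrace !big_ord_recl big_ord0 addr0 !mxE /psi /=.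
case: (odd _) => /=; first by rewrite addr0.
by rewrite -mulrDr zpow_sum; case: ifP => _; rewrite ?mulrN1 // mulrC.
Qed.

Lemma rho_Aint k x p q : rho k x p q \in Aint.
Proof.
have zA := Aint_prim_root z_prim; have wA := Aint_prim_root (omega_prim n_gt0).
by rewrite mxE /zpow; case: ifP => _; rewrite ?rpred0 // rpredM ?rpredX.
Qed.

End Representations.

Lemma Aint_sqrt_int (c lambda : algC) :
  (c \in Num.int -> lambda ^+ 2 = c -> lambda \in Aint)%R.
Proof.
move=> c_int lambda2; apply: (@root_monic_Aint ('X^2 - c%:P)%R).
- by rewrite /root !hornerE lambda2 subrr.
- exact: monicXnsubC.
by apply/polyOverP=> i; rewrite coefB coefC coefXn rpredB ?rpred_nat //; case: ifP => _; rewrite ?rpred0.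
Qed.

(** * The spectrum of the Cayley graph of U_6n *)

Section Spectrum.
Variables (n : nat) (SL S2 : {set U6 n}).
Hypothesis n_gt0 : (0 < n)%N.
Local Notation a := (U6a n).
Local Notation b := (U6b n).
Hypothesis SLa : SL \subset <[a ^+ 2]>.
Hypothesis S2odd : forall x, x \in S2 -> odd x.1.
Let S := (SL :* b) :|: (SL :* b ^+ 2) :|: S2.
Hypothesis SV : S^-1 = S.
Local Open Scope ring_scope.

Lemma U6_mul_b (x : U6 n) : (x * b)%g = (x.1, x.2 + 1).
Proof. by rewrite [LHS]/(U6mul _ _) /U6mul /= addr0. Qed.

Lemma U6_mul_b2 (x : U6 n) : (x * b ^+ 2)%g = (x.1, x.2 + 2).
Proof. by rewrite expgS expg1 mulgA !U6_mul_b /= -addrA. Qed.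

(** The three pieces of [S] are disjoint: the parity of the exponent of a separates [S2] from the
    others, and the exponent of b separates the two cosets. *)
Lemma sum_connection_set (V : zmodType) (F : U6 n -> V) :
  \sum_(s in S) F s =
  \sum_(y in SL) (F (y * b)%g + F (y * b ^+ 2)%g) + \sum_(s in S2) F s.
Proof.
have evSL y : y \in SL -> ~~ odd y.1 /\ y.2 = 0.
  by move=> /(subsetP SLa); rewrite mem_a2 // => /andP[? /eqP].
have evb x : x \in (SL :* b)%g -> ~~ odd x.1 /\ x.2 = 1.
  by case/rcosetP=> y /evSL[ev y2] ->; rewrite U6_mul_b /= y2 add0r.
have evb2 x : x \in (SL :* b ^+ 2)%g -> ~~ odd x.1 /\ x.2 = 2.
  by case/rcosetP=> y /evSL[ev y2] ->; rewrite U6_mul_b2 /= y2 add0r.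
have sum_rcoset g : \sum_(s in (SL :* g)%g) F s = \sum_(y in SL) F (y * g)%g.
  by rewrite (reindex_inj (mulIg g)); apply: eq_bigl => y; rewrite mem_rcoset mulgK.
have sum_setU (A B : {set U6 n}) : [disjoint A & B] ->
    \sum_(s in A :|: B) F s = \sum_(s in A) F s + \sum_(s in B) F s.
  by move=> dAB; rewrite -bigU //; apply: eq_bigl => x; rewrite !inE.
rewrite /S sum_setU; last first.
  apply/pred0P => x /=; apply/negP => /andP[x12 /S2odd xod]; case/setUP: x12.
    by case/evb; rewrite xod.
  by case/evb2; rewrite xod.
rewrite sum_setU; last first.
  by apply/pred0P => x /=; apply/negP => /andP[/evb[_ x1] /evb2[_]]; rewrite x1.
by rewrite !sum_rcoset big_split.
Qed.

Lemma chi_connection_set j :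
  char_set (chi j) S = 2 * char_set (chi j) SL + char_set (chi j) S2.
Proof.
rewrite /char_set sum_connection_set mulr_sumr; congr (_ + _).
apply: eq_bigr => y _; by rewrite U6_mul_b U6_mul_b2 mulr_natl.
Qed.

Lemma rho_connection_set (z : algC) k : 3.-primitive_root z ->
  exists c, [/\ c \in Aint, char_sq (psi k) S2 = 2 * c &
    forall lambda, eigenvalue (\sum_(s in S) rho z k s) lambda =
                   ((lambda + char_set (chi k) SL) ^+ 2 == c)].
Proof.
move=> z_prim; pose Q := \sum_(s in S2) rho z k s; pose M := \sum_(s in S) rho z k s.
have Qdiag p : Q p p = 0.
  rewrite summxE big1 // => s /S2odd od.
  by rewrite mxE od eqxx.
have evSL y : y \in SL -> ~~ odd y.1 /\ y.2 = 0.
  by move=> /(subsetP SLa); rewrite mem_a2 // => /andP[? /eqP].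
have ME p q : M p q = (if p == q then - char_set (chi k) SL else 0) + Q p q.
  rewrite /M sum_connection_set mxE; congr (_ + _).
  rewrite summxE; have [->|npq] := eqVneq p q; last first.
    rewrite big1 // => y /evSL[ev _]; rewrite !mxE U6_mul_b U6_mul_b2 /= npq.
    by rewrite (negPf ev) /= addr0.
  rewrite /char_set -sumrN; apply: eq_bigr => y /evSL[ev y2].
  rewrite !mxE U6_mul_b U6_mul_b2 /= eqxx (negPf ev) /= y2 !add0r -mulrDr.
  (* b and b^2 act as diag(z, z^-1) and its inverse, so their sum acts as -1; this gives the scalar
     part -sigma_k. *)
  have zb : zpow z 1 + zpow z (- 1) = -1 by rewrite zpow_sum.
  rewrite -[RHS]mulrN1 -zb; congr (_ * _); case: ifP => _; last rewrite addrC;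
    by congr (zpow _ _ + zpow _ _); apply: val_inj.
(* [Q] has zero diagonal, so its square is this scalar times the identity, with trace twice the
   scalar. *)
exists (Q 0 1 * Q 1 0); split.
- by rewrite !summxE rpredM // rpred_sum // => s _; apply: rho_Aint.
- transitivity (char_sq (fun x => \tr (rho z k x)) S2).
    by apply: eq_bigr => x _; apply: eq_bigr => y _; rewrite mxtrace_rho.
  rewrite char_sq_mxtrace; last exact: rhoM.
  rewrite -/Q /mxtrace !big_ord_recl big_ord0 !mxE !big_ord_recl !big_ord0.
  have -> : lift ord0 ord0 = 1 :> 'I_2 by apply: val_inj.
  rewrite -[ord0]/(0 : 'I_2) !Qdiag; ring.
move=> lambda; rewrite (@eigenvalue_mx2 _ _ (- char_set (chi k) SL)) -/M ?ME ?eqxx ?Qdiag ?addr0 //.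
by rewrite opprK !add0r.
Qed.

Lemma eigenvalue_cay_chi j : eigenvalue (cay_adj S) (char_set (chi j) S).
Proof.
pose r (x : U6 n) : 'M[algC]_1 := (chi j x)%:M.
apply: (@eigenvalue_cay_adj _ _ SV 1%N r).
- by rewrite /r chi1.
- by move=> x y; rewrite /r chiM // scalar_mxM.
rewrite -raddf_sum; apply/eigenvalueP; exists (1%:M : 'M_1).
  by rewrite mul1mx scalemx1.
by rewrite oner_eq0.
Qed.

(** If lambda came from no representation, the sums of [v] against all translated characters would
    vanish. Weighting them as in the regular character would give 6n times each entry of [v] equal
    to 0. *)
Lemma eigenvalue_cay_adj_cases (z lambda : algC) :
  3.-primitive_root z -> eigenvalue (cay_adj S) lambda ->
  (exists2 j, (j < n.*2)%N & lambda = char_set (chi j) S) \/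
  (exists2 k, (k < n)%N & eigenvalue (\sum_(s in S) rho z k s) lambda).
Proof.
move=> z_prim /eigenvalueP[v vS nz_v].
have [/existsP[j /eqP ->]|no_j] := boolP [exists j : 'I_n.*2, lambda == char_set (chi j) S].
  by left; exists j; rewrite ?ltn_ord.
have [/existsP[k kE]|no_k] :=
  boolP [exists k : 'I_n, eigenvalue (\sum_(s in S) rho z k s) lambda].
  by right; exists k; rewrite ?ltn_ord.
case/eqP: nz_v; apply/rowP=> i; rewrite -[i]enum_valK mxE; set x := enum_val i.
have chi0 (j : 'I_n.*2) : \sum_h v 0 (enum_rank h) * chi j (h^-1 * x)%g = 0.
  pose r (x : U6 n) : 'M[algC]_1 := (chi j x)%:M.
  rewrite -[RHS](@eigenvector_cay_adj_orthogonal _ _ SV 1%N r _ lambda v vS _ x).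
  - by apply: eq_bigr => h _; rewrite mxtrace_scalar.
  - by move=> g h; rewrite /r chiM // scalar_mxM.
  rewrite -raddf_sum; apply: contra no_j => /eigenvalueP[u].
  rewrite mul_mx_scalar => /eqP; rewrite -subr_eq0 -scalerBl scaler_eq0 subr_eq0.
  by case/orP=> [/eqP e _|->] //; apply/existsP; exists j; rewrite -e.
have psi0 (k : 'I_n) : \sum_h v 0 (enum_rank h) * psi k (h^-1 * x)%g = 0.
  have noE : ~~ eigenvalue (\sum_(s in S) rho z k s) lambda.
    by apply: contra no_k => kE; apply/existsP; exists k.
  rewrite -[RHS](eigenvector_cay_adj_orthogonal SV _ vS noE x); last exact: rhoM.
  by apply: eq_bigr => h _; rewrite mxtrace_rho.
have : \sum_h v 0 (enum_rank h) *
    (\sum_(j < n.*2) chi j (h^-1 * x)%g + 2 * \sum_(k < n) psi k (h^-1 * x)%g) = 0.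
  transitivity (\sum_(j < n.*2) (\sum_h v 0 (enum_rank h) * chi j (h^-1 * x)%g) +
    2 * \sum_(k < n) \sum_h v 0 (enum_rank h) * psi k (h^-1 * x)%g).
    rewrite exchange_big [X in _ + 2 * X]exchange_big mulr_sumr -big_split /=.
    by apply: eq_bigr => h _; rewrite -!mulr_sumr mulrDr [in LHS]mulrCA.
  by rewrite !big1 ?mulr0 ?addr0.
rewrite (bigD1 x) //= [X in _ + X = _]big1 ?addr0 => [|h nhx]; last first.
  by rewrite regular_character // -(eq_mulVg1 h x) (negPf nhx) mulr0.
rewrite regular_character // mulVg eqxx => /eqP; rewrite mulf_eq0 pnatr_eq0.
by rewrite muln_eq0 /= -leqn0 leqNgt n_gt0 orbF => /eqP.
Qed.

End Spectrum.

(** Rationality is all that halving preserves; integrality is recovered later from rational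
    algebraic integers being integers. *)
Lemma intC_half (x : algC) : (2 * x \in Num.int -> x \in Crat)%R.
Proof.
move=> x2; rewrite -[x](mulKf (_ : 2 != 0)%R) ?pnatr_eq0 //.
by rewrite rpredM ?rpredV ?rpred_nat // rpred_int_num.
Qed.

Lemma odd_cosets_a2 n (x : U6 n) : (0 < n)%N ->
  x \in (<[U6a n ^+ 2]> :* U6a n) :|: (<[U6a n ^+ 2]> :* (U6a n * U6b n))
      :|: (<[U6a n ^+ 2]> :* (U6a n * U6b n ^+ 2)) -> odd x.1.
Proof.
move=> n_gt0; have odd1 : odd (1%R : 'Z_(n.*2)) by [].
have odd_coset (g : U6 n) : odd g.1 -> x \in <[U6a n ^+ 2]> :* g -> odd x.1.
  move=> og /rcosetP[y]; rewrite mem_a2 // => /andP[ev _] ->.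
  by rewrite [odd _]U6_odd_add (negPf ev).
by rewrite !in_setU => /orP[/orP[]|]; apply: odd_coset; rewrite ?mulgA ?U6_mul_b2 ?U6_mul_b.
Qed.

(** * Both directions of the integrality criterion *)

Section Criterion.
Variables (n : nat) (SL S2 : {set U6 n}).
Hypothesis n_gt0 : (0 < n)%N.
Hypothesis SLa : SL \subset <[U6a n ^+ 2]>.
Hypothesis S2odd : forall x, x \in S2 -> odd x.1.
Let S := (SL :* U6b n) :|: (SL :* U6b n ^+ 2) :|: S2.
Hypothesis SV : S^-1 = S.
Local Open Scope ring_scope.

Let sigma j := char_set (chi j) SL.

Lemma sigma_int j : gen_closed SL -> sigma j \in Num.int.
Proof. by move=> cSL; apply: gen_closed_char_set_int => //; apply: chiM. Qed.

Lemma sigma_Aint j : sigma j \in Aint.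
Proof. by apply: char_set_Aint; [exact: chi1 | exact: chiM]. Qed.

Lemma sigma_int_gen_closed : (forall k, (k < n)%N -> sigma k \in Num.int) -> gen_closed SL.
Proof.
move=> intS.
apply: (@char_set_int_gen_closed _ <[U6a n ^+ 2]>%G _ (fun k : 'I_n => @chi n k) _ _ n%:R) => //.
- by move=> k; apply: chi1.
- by move=> k; apply: chiM.
- by rewrite pnatr_eq0 -lt0n.
- exact: sum_chi_even.
by move=> k; apply: intS.
Qed.

Lemma integral_cay_adj_necessary : integral_mx (cay_adj S) ->
  [/\ gen_closed SL, forall j, char_set (chi j) S2 \in Num.int &
      forall k, (k < n)%N -> exists m : int, 2 * char_sq (psi k) S2 = m%:~R ^+ 2].
Proof.
move=> intS; have [z z_prim] := @C_prim_root_exists 3 isT.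
(* With q a square root of c, the eigenvalues at [rho z k] are q - sigma_k and -(q + sigma_k), and 2
   psi_k(S2^2) = 4c. *)
have half k : (k < n)%N -> exists q, [/\ q + sigma k \in Num.int, q - sigma k \in Num.int &
    2 * char_sq (psi k) S2 = (2 * q) ^+ 2].
  move=> lt_kn; have [c [_ psiE eigE]] := rho_connection_set n_gt0 SLa S2odd k z_prim.
  have eig lambda : (lambda + sigma k) ^+ 2 = c -> lambda \in Num.int.
    move=> e; apply: intS; apply: (eigenvalue_cay_adj SV (rho1 n z k)).
      exact: rhoM.
    by rewrite eigE e.
  exists (sqrtC c); split.
  - rewrite -rpredN opprD; apply: eig.
    by rewrite subrK sqrrN sqrtCK.
  - by apply: eig; rewrite subrK sqrtCK.
  by rewrite psiE exprMn sqrtCK expr2 mulrA.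
have sig_int k : (k < n)%N -> sigma k \in Num.int.
  move=> /half[q [qD qB _]]; apply: Cint_rat_Aint (sigma_Aint k).
  apply: intC_half; have -> : 2 * sigma k = (q + sigma k) - (q - sigma k) by ring.
  exact: rpredB.
have cSL := sigma_int_gen_closed sig_int.
split=> // [j|k lt_kn].
  (* Here j may be n or more; closure under generators makes every sigma_j an integer, not only
     those with index below n. *)
  have := intS _ (eigenvalue_cay_chi n_gt0 SV j).
  by rewrite chi_connection_set // rpredDl // rpredM ?rpred_nat ?sigma_int.
have [q [qD _ ->]] := half k lt_kn.
have : 2 * q \in Num.int.
  rewrite rpredM ?rpred_nat //; rewrite -[q](addrK (sigma k)).
  by rewrite rpredB // sig_int.
by case/intrP=> m ->; exists m.
Qed.

Lemma integral_cay_adj_sufficient :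
  gen_closed SL -> (forall j, (j < n.*2)%N -> char_set (chi j) S2 \in Num.int) ->
  (forall k, (k < n)%N -> exists m : int, 2 * char_sq (psi k) S2 = m%:~R ^+ 2) ->
  integral_mx (cay_adj S).
Proof.
move=> cSL chi_int psi_sq lambda; have [z z_prim] := @C_prim_root_exists 3 isT.
case/(eigenvalue_cay_adj_cases n_gt0 SV z_prim) => [[j lt_j ->]|[k lt_k]].
  by rewrite chi_connection_set // rpredD ?chi_int // rpredM ?rpred_nat ?sigma_int.
have [c [cA psiE ->]] := rho_connection_set n_gt0 SLa S2odd k z_prim.
rewrite -/(sigma k); set t := lambda + _; move=> /eqP t2.
have [m mE] := psi_sq k lt_k.
(* Condition (3) gives (2t)^2 = m^2, so t is m/2 or -m/2. Then c = t^2 is a rational algebraic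
   integer, hence an integer, and t, a root of X^2 - c, is an integer too. *)
have tR : t \in Crat.
  apply: intC_half; have : (2 * t) ^+ 2 = m%:~R ^+ 2 by rewrite -mE psiE -t2; ring.
  by move/eqP; rewrite eqf_sqr => /pred2P[] ->; rewrite ?rpredN rpred_int.
have t_int : t \in Num.int.
  apply: (Cint_rat_Aint tR); apply: (Aint_sqrt_int _ t2).
  by rewrite Cint_rat_Aint // -t2 rpredX.
by rewrite -(addrK (sigma k) lambda) rpredB ?sigma_int.
Qed.

End Criterion.


Theorem theorem4p4 (n : nat) (L : {set 'I_n}) (S2 : {set U6 n}) :
  (0 < n)%N ->
  let a := U6a n in
  let b := U6b n in
  let S1 := [set a ^+ (2 * l) * b | l : 'I_n in L] :|: [set a ^- (2 * l) * b ^+ 2 | l : 'I_n in L] in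
  let S := S1 :|: S2 in
  let SL := [set a ^+ (2 * l) | l : 'I_n in L] in
  S2 \subset (<[a ^+ 2]> :* a) :|: (<[a ^+ 2]> :* (a * b)) :|: (<[a ^+ 2]> :* (a * b ^+ 2)) ->
  1 \notin S -> S^-1 = S -> SL^-1 = SL ->
  (integral_mx (cay_adj S) <->
   [/\ in_boolalg <[a ^+ 2]>%G SL,
       (forall j : nat, (j < n.*2)%N -> char_set (chi j) S2 \in Num.int) &
       (forall k : nat, (k < n)%N ->
          exists m : int, (2 * char_sq (psi k) S2 = (m%:~R) ^+ 2)%R)]).
Proof.
move=> n_gt0 a b S1 S SL sS2 _ SV SLV.
have SLa : SL \subset <[a ^+ 2]>.
  by apply/subsetP=> _ /imsetP[l _ ->]; rewrite expgM mem_cycle.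
have S2odd x : x \in S2 -> odd x.1.
  by move/(subsetP sS2); apply: odd_cosets_a2.
have powSL (l : 'I_n) : l \in L -> a ^+ (2 * l) \in SL by move=> lL; apply/imsetP; exists l.
(* The elements a^(-2l) b^2 form the coset of [SL^-1], which equals [SL] by assumption; only the
   second occurrence of [SL] is rewritten. *)
have SE : S = (SL :* b) :|: (SL :* b ^+ 2) :|: S2.
  rewrite /S /S1 -{2}SLV; congr (_ :|: _ :|: _); apply/setP=> x.
    apply/imsetP/rcosetP=> [[l /powSL aS ->]|[_ /imsetP[l lL ->] ->]]; last by exists l.
    by exists (a ^+ (2 * l)).
  apply/imsetP/rcosetP=> [[l /powSL aS ->]|[y]].
    by exists (a ^- (2 * l)); rewrite ?mem_invg ?invgK.
  rewrite mem_invg => /imsetP[l lL yE] ->; exists l => //.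
  by rewrite -yE invgK.
rewrite SE in SV *; split=> [intS|[BSL chi_int psi_sq]].
  have [cSL chi_int psi_sq] := integral_cay_adj_necessary n_gt0 SLa S2odd SV intS.
  by split=> //; apply: gen_closed_in_boolalg.
exact: integral_cay_adj_sufficient (in_boolalg_gen_closed BSL) chi_int psi_sq.
Qed.
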